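(* Let $G=G(n,1/2)$ be the binomial random graph on $n$ vertices. Then with probability tending to $1$ as $n\to\infty$, $HG(G)\ge n^{1-o(1)}$.
   Context: $G(n,1/2)$ is the random graph on $n$ labeled vertices in which each pair of vertices is joined by an edge independently with probability $1/2$. The hat guessing game on a finite simple graph $G$ with $q$ colors: each vertex (player) is assigned a hat whose color is an arbitrary element of a fixed set $Q$ of $q$ colors. Each player sees the hat colors of exactly its neighbors in $G$ (not its own). Before the colors are assigned, the players fix a deterministic guessing strategy: for each vertex $w$, a function from the colorings of the neighbors of $w$ to $Q$, which is $w$'s guess for its own color. No communication is allowed. The strategy is winning if for every assignment of colors from $Q$ to all vertices, at least one vertex guesses its own color correctly. The hat guessing number $HG(G)$ is the largest integer $q$ for which a winning strategy with $q$ colors exists. *)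

(* Defs.v *)
From mathcomp Require Import all_boot.
From mathcomp Require Import boolp.
From Stdlib Require Import Reals.

Set Implicit Arguments.
Unset Strict Implicit.
Unset Printing Implicit Defensive.

Definition is_graph (n : nat) (E : {set {set 'I_n}}) : bool :=
  [forall e in E, #|e| == 2].

Definition graphs (n : nat) : {set {set {set 'I_n}}} :=
  [set E : {set {set 'I_n}} | is_graph E].

Definition adj (n : nat) (E : {set {set 'I_n}}) (u v : 'I_n) : bool :=
  (u != v) && ([set u; v] \in E).

(* A guessing strategy with q colors ('I_q): vertex v's guess is a function of
   the full coloring that depends only on the colors of the neighbours of v. *)
Definition sees_only_neighbours (n q : nat) (E : {set {set 'I_n}})
  (f : 'I_n -> {ffun 'I_n -> 'I_q} -> 'I_q) : Prop :=
  forall (v : 'I_n) (c c' : {ffun 'I_n -> 'I_q}),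
    (forall u, adj E v u -> c u = c' u) -> f v c = f v c'.

Definition winning (n q : nat) (E : {set {set 'I_n}}) : Prop :=
  exists f : 'I_n -> {ffun 'I_n -> 'I_q} -> 'I_q,
    sees_only_neighbours E f /\
    forall c : {ffun 'I_n -> 'I_q}, exists v : 'I_n, f v c = c v.

(* HG(G) >= x : the largest q with a winning strategy is at least x,
   i.e. some q >= x admits a winning strategy. *)
Definition HG_ge (n : nat) (E : {set {set 'I_n}}) (x : R) : Prop :=
  exists q : nat, (x <= INR q)%R /\ winning q E.

(* Probability of an event in G(n,1/2): uniform measure on all labeled graphs
   on n vertices. *)
Definition prob_Gn (n : nat) (P : {set {set 'I_n}} -> Prop) : R :=
  (INR #|[set E in graphs n | `[< P E >]]| / INR #|graphs n|)%R.

(* Main.v *)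
(** With high probability every set of d ~ log n / log log n vertices has a
    common neighbour in each of N ~ d^d disjoint blocks of n^o(1) vertices. Such
    a graph contains, by greedy extension, a clique on d vertices together with N
    common neighbours, the pages. With q = d^(d - 3) = n^(1 - o(1)) colours, let
    each page guess a random function of the q^d colourings of the clique: by a
    union bound, some choice of functions has one of them onto on every set of
    2 d^2 q clique colourings, so that whatever the colours of the pages, at most
    d^d clique colourings make all pages guess wrong. The clique players can win
    on any such set S: it suffices to choose injectively for each point of S an
    axis-parallel line through it, which Hall's theorem provides since by
    Loomis-Whitney and AM-GM a set of t <= d^d points meets at least
    d t^((d - 1) / d) >= t lines. *)

From mathcomp Require Import all_boot ssralg ssrnum ssrint boolp zify.
From Stdlib Require Import Reals Lra.
From mathcomp Require Import ssrnat finfun.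
Require Import Defs.

Set Implicit Arguments.
Unset Strict Implicit.
Unset Printing Implicit Defensive.

(** * Inequalities between powers of natural numbers *)

(** AM-GM for the [k + 1] numbers [k * M, B, ..., B], with a common factor [k] cancelled. *)
Lemma weighted_AGM (k M B : nat) :
  k.+1 ^ k.+1 * (M * B ^ k) <= k ^ k * (M + B) ^ k.+1.
Proof.
case: k => [|k]; first by rewrite !expn1 !expn0 !mul1n muln1 leq_addr.
pose e (i : 'I_k.+2) := if i == ord0 then k.+1 * M else B.
have := @Num.Theory.leif_AGM_scaled int 'I_k.+2 predT (fun i => GRing.natmul (GRing.one int) (e i)).
rewrite card_ord => AG.
have {AG} := (AG (fun i _ => Num.Theory.mulrn_wge0 _ (Num.Theory.ler0n _ _))).1.
under eq_bigr do rewrite -GRing.mulrnA.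
rewrite -GRing.natr_sum -GRing.natr_prod -GRing.natrX Num.Theory.ler_nat.
rewrite big_ord_recl [in X in _ <= X -> _]big_ord_recl /= /e /=.
rewrite prod_nat_const sum_nat_const card_ord mulnA.
rewrite -mulnDr expnMn expnMn => H.
rewrite -(@leq_pmul2l k.+1) //; apply: leq_trans (_ : k.+1 ^ k.+2 * (M + B) ^ k.+2 <= _); last first.
  by rewrite mulnA -expnS.
apply: leq_trans H; rewrite (expnS k.+2) eq_leq //; lia.
Qed.

Lemma pow_succ_ge (a n : nat) : a ^ n.+1 + n.+1 * a ^ n <= a.+1 ^ n.+1.
Proof.
elim: n => [|n IH]; first by rewrite !expn1 expn0 muln1 addn1.
rewrite (expnS a.+1) mulSn.
apply: leq_trans (leq_add IH (leq_mul (leqnn a) IH)).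
rewrite mulnDr -expnS (mulnCA a) -expnS; set x := a ^ n.+2; set y := a ^ n.+1. 
have : y + n.+1 * y = n.+2 * y by rewrite mulSn.
lia.
Qed.

(** Integer form of [(1 - 1/x)^x <= 1/2]. It serves both random choices: of the page functions and
    of the graph. *)
Lemma double_pred_pow (x : nat) : 0 < x -> 2 * x.-1 ^ x <= x ^ x.
Proof.
case: x => // a _ /=; apply: leq_trans (pow_succ_ge a a).
by rewrite mul2n -addnn leq_add2l expnS leq_mul.
Qed.

(** In terms of roots, [b <= M^(1/k) a] and [e <= M^(1/k) c] are added. Roots are avoided by
    bounding the ratio of the sums by the larger ratio, say [e / c]. *)
Lemma pow_ratio_sum2 (k M a b c e : nat) :
  0 < k -> b ^ k <= M * a ^ k -> e ^ k <= M * c ^ k -> (b + e) ^ k <= M * (a + c) ^ k.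
Proof.
move=> k0; wlog H : a b c e / b * c <= e * a.
  move=> W ba ec; case: (leqP (b * c) (e * a)) => [/W|]; first exact.
  by move/ltnW/W; rewrite (addnC b) (addnC a); apply.
move=> ba ec; case: (posnP c) => [c0|c0].
  move: ec; rewrite c0 exp0n // muln0 leqn0 expn_eq0 k0 andbT => /eqP ->.
  by rewrite !addn0.
rewrite -(@leq_pmul2r (c ^ k)) ?expn_gt0 ?c0 // -expnMn.
apply: (@leq_trans ((e * (a + c)) ^ k)).
  by rewrite leq_exp2r // mulnDl mulnDr leq_add2r.
by rewrite expnMn mulnAC leq_mul2r ec orbT.
Qed.

Lemma pow_ratio_sum (I : finType) (k M : nat) (a b : I -> nat) :
  0 < k -> (forall i, b i ^ k <= M * a i ^ k) ->
  (\sum_i b i) ^ k <= M * (\sum_i a i) ^ k.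
Proof.
move=> k0 H; apply: (big_ind2 (fun y x => y ^ k <= M * x ^ k)) => //.
  by rewrite !exp0n.
by move=> *; apply: pow_ratio_sum2.
Qed.

(** * Hall's theorem *)

Lemma bigcup_setD (T U : finType) (A : T -> {set U}) (S : {set T}) (B : {set U}) :
  \bigcup_(x in S) (A x :\: B) = (\bigcup_(x in S) A x) :\: B.
Proof.
apply/setP => u; rewrite inE; apply/bigcupP/andP => [[x xS]|[uB /bigcupP[x xS uA]]].
  by rewrite inE => /andP[uB uA]; split=> //; apply/bigcupP; exists x.
by exists x; rewrite // inE uB.
Qed.

(** Induction on [#|S|]. If a nonempty proper subset [S'] is tight, [S'] is matched first and the
    rest of [S] is matched outside the union [B] of the sets of [S']. Otherwise every nonempty
    proper subset has an element to spare, so [x0] may take any [u] in [A x0]. The default [u0]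
    gives [h] when [S] is empty. *)
Lemma hall (T U : finType) (u0 : U) (A : T -> {set U}) (S : {set T}) :
  (forall S' : {set T}, S' \subset S -> #|S'| <= #|\bigcup_(x in S') A x|) ->
  exists h : T -> U, {in S, forall x, h x \in A x} /\ {in S &, injective h}.
Proof.
have [n] := ubnP #|S|; elim: n S A => // n IH S A; rewrite ltnS => leSn H.
have [S0|[x0 x0S]] := set_0Vmem S.
  by exists (fun=> u0); split=> [x|x y]; rewrite S0 inE.
have [/existsP[S' /and3P[S'S S'0 tight]]|loose] := boolP [exists S' : {set T},
    [&& S' \proper S, S' != set0 & #|\bigcup_(x in S') A x| <= #|S'|]].
  have S'S1 := proper_sub S'S.
  have [h1 [h1A h1I]] : exists h : T -> U,
      {in S', forall x, h x \in A x} /\ {in S' &, injective h}.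
    apply: IH; first exact: leq_trans (proper_card S'S) leSn.
    by move=> S2 S2S'; apply: H; apply: subset_trans S2S' _.
  set B := \bigcup_(x in S') A x in tight.
  have [h2 [h2A h2I]] : exists h : T -> U,
      {in S :\: S', forall x, h x \in A x :\: B} /\ {in S :\: S' &, injective h}.
    apply: IH => [|S2].
      apply: leq_trans leSn; rewrite cardsD (setIidPr S'S1) ltn_subrL.
      by rewrite !card_gt0 S'0; apply/set0Pn; exists x0.
    rewrite subsetD bigcup_setD => /andP[S2S dis].
    have := H (S2 :|: S'); rewrite subUset S2S S'S1 => /(_ isT).
    rewrite bigcup_setU -/B cardsU (disjoint_setI0 dis) cards0 subn0.
    have -> : #|\bigcup_(x in S2) A x :|: B| = #|(\bigcup_(x in S2) A x) :\: B| + #|B|.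
      by rewrite cardsU cardsD; have := subset_leq_card (subsetIl (\bigcup_(x in S2) A x) B); lia.
    by move: tight; lia.
  exists (fun x => if x \in S' then h1 x else h2 x); split=> [x xS|x y xS yS].
    case: ifPn => [/h1A //|xS']; have := h2A x; rewrite !inE xS xS' => /(_ isT).
    by case/andP.
  have inB z : z \in S' -> h1 z \in B by move=> zS'; apply/bigcupP; exists z; rewrite ?h1A.
  have ninB z : z \in S -> z \notin S' -> h2 z \notin B.
    by move=> zS zS'; have := h2A z; rewrite !inE zS zS' => /(_ isT) /andP[].
  case: ifPn => xS'; case: ifPn => yS'; first exact: h1I.
  - by move=> e; move: (inB _ xS'); rewrite e (negPf (ninB _ yS yS')).
  - by move=> e; move: (inB _ yS'); rewrite -e (negPf (ninB _ xS xS')).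
  - by apply: h2I; rewrite inE ?xS' ?yS'.
have [u uA] : exists u, u \in A x0.
  have := H [set x0]; rewrite sub1set x0S big_set1 cards1 => /(_ isT) /card_gt0P [u uA].
  by exists u.
have [h [hA hI]] : exists h : T -> U,
    {in S :\ x0, forall x, h x \in A x :\ u} /\ {in S :\ x0 &, injective h}.
  apply: IH => [|S2]; first by rewrite (cardsD1 x0 S) x0S in leSn.
  rewrite subsetD1 bigcup_setD => /andP[S2S x0S2].
  have [->|S20] := eqVneq S2 set0; first by rewrite cards0.
  move: loose; rewrite negb_exists => /forallP /(_ S2); rewrite S20 /=.
  have SS2 : ~~ (S \subset S2) by apply: contra x0S2 => /subsetP; apply.
  rewrite properE S2S SS2 /= -ltnNge (cardsD1 u (\bigcup_(x in S2) A x)) => lt.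
  by rewrite -ltnS; apply: leq_trans lt _; rewrite -[leqRHS]add1n leq_add2r leq_b1.
exists (fun x => if x == x0 then u else h x); split=> [x xS|x y xS yS].
  case: eqVneq => [->//|xx0]; have := hA x; rewrite !inE xS xx0 => /(_ isT).
  by case/andP.
have neu z : z \in S -> z != x0 -> h z != u.
  by move=> zS zx; have := hA z; rewrite !inE zS zx => /(_ isT) /andP[].
case: eqVneq => [->|xx0]; case: eqVneq => [->|yx0] //.
- by move=> e; move: (neu _ yS yx0); rewrite -e eqxx.
- by move=> e; move: (neu _ xS xx0); rewrite e eqxx.
- by apply: hI; rewrite !inE ?xx0 ?yx0.
Qed.

(** * Loomis-Whitney and the game on a clique *)

Lemma card_fibers (T U : finType) (f : T -> U) (S : {set T}) :
  #|S| = \sum_a #|[set x in S | f x == a]|.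
Proof.
rewrite -sum1_card (partition_big f predT) //=; apply: eq_bigr => a _.
by rewrite -sum1_card; apply: eq_bigl => x; rewrite inE.
Qed.

Section HatCoordinates.

Variables (I Q : finType) (o : Q).
Implicit Types (x y : {ffun I -> Q}) (S T : {set {ffun I -> Q}}) (D : {set I}).

(* The pair [(i, erase i x)] represents the line through [x] parallel to the
   [i]-th axis. *)
Definition erase i x : {ffun I -> Q} := [ffun j => if j == i then o else x j].

Lemma erase_other i j x : j != i -> erase i x j = x j.
Proof. by rewrite ffunE => /negPf ->. Qed.

Lemma erase_inj i x y : x i = y i -> erase i x = erase i y -> x = y.
Proof.
move=> e /ffunP E; apply/ffunP => j; have := E j; rewrite !ffunE.
by case: eqVneq => [->|].
Qed.

Lemma eq_erase i x y : (forall j, j != i -> x j = y j) -> erase i x = erase i y.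
Proof. by move=> e; apply/ffunP => j; rewrite !ffunE; case: eqVneq => // /e. Qed.

(* By induction on [D], slicing [T] along a coordinate: the inductive step is an
   instance of AM-GM. *)
Lemma loomis_whitney D T :
  T != set0 -> {in T &, forall x y i, i \notin D -> x i = y i} ->
  #|D| ^ #|D| * #|T| ^ #|D| <= #|T| * (\sum_(i in D) #|erase i @: T|) ^ #|D|.
Proof.
move: {2}#|D| (erefl #|D|) => k; elim: k D T => [|k IH] D T kD T0 agree.
  by rewrite kD !expn0 !muln1 card_gt0.
have [j jD] : exists j, j \in D by apply/card_gt0P; rewrite kD.
have kD' : #|D :\ j| = k by move: kD; rewrite (cardsD1 j) jD => -[].
pose slice a := [set x in T | x j == a].
pose L a := \sum_(i in D :\ j) #|erase i @: slice a|.
set M := #|erase j @: T|.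
have M_gt0 : 0 < M by rewrite card_gt0 imset_eq0.
(* Points of one slice lie on distinct lines of direction [j]. *)
have leM a : #|slice a| <= M.
  rewrite -(@card_in_imset _ _ (erase j) (slice a)).
    by apply/subset_leq_card/imsetS/subsetP => x; rewrite inE => /andP[].
  by move=> x y; rewrite !inE => /andP[_ /eqP xa] /andP[_ /eqP ya]; apply: erase_inj; rewrite xa ya.
(* A line of direction [i != j] keeps its coordinate [j], so different slices share no such line. *)
have sumL : M + \sum_a L a <= \sum_(i in D) #|erase i @: T|.
  rewrite (big_setD1 j jD) leq_add2l /L exchange_big /=; apply: leq_sum => i.
  rewrite !inE => /andP[ij _]; rewrite (card_fibers (fun y => y j) (erase i @: T)).
  apply: leq_sum => a _; apply/subset_leq_card/subsetP => _ /imsetP[x + ->].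
  rewrite !inE => /andP[xT /eqP <-]; rewrite imset_f // erase_other 1?eq_sym //.
  by rewrite eqxx.
(* For each slice the induction hypothesis and [leM] give [(k * #|slice a|)^k <= M * (L a)^k]; these
   bounds add up under [k]-th roots. *)
have Mk : (k * #|T|) ^ k <= M * (\sum_a L a) ^ k.
  case: (posnP k) => [->|k0]; first by rewrite !expn0 muln1.
  rewrite (card_fibers (fun y => y j)) big_distrr; apply: pow_ratio_sum => // a.
  rewrite -/(slice a); have [->|Ta0] := eqVneq (slice a) set0.
    by rewrite /= cards0 muln0 exp0n.
  apply: leq_trans (leq_mul (leM a) (leqnn _)).
  rewrite expnMn -kD'; apply: IH => // x y; rewrite !inE => /andP[xT /eqP xa] /andP[yT /eqP ya] i.
  rewrite !inE negb_and negbK => /predU1P[->|]; [by rewrite xa ya|exact: agree].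
rewrite kD (expnS #|T|) mulnCA leq_pmul2l ?card_gt0 //.
apply: leq_trans (leq_trans _ (_ : (M + \sum_a L a) ^ k.+1 <= _)); last by rewrite leq_exp2r.
  exact: leqnn.
have kk : 0 < k ^ k by case: (k) => // k'; rewrite expn_gt0.
rewrite -(leq_pmul2l kk); apply: leq_trans (weighted_AGM _ _ _).
by rewrite mulnCA leq_mul2l -expnMn Mk orbT.
Qed.

(* [g i] is the guess of player [i], who sees all the other coordinates. *)
Lemma clique_wins_on_small_set S :
  0 < #|I| -> #|S| <= #|I| ^ #|I| ->
  exists g : I -> {ffun I -> Q} -> Q,
    (forall i x y, (forall j, j != i -> x j = y j) -> g i x = g i y) /\
    {in S, forall x, exists i, g i x = x i}.
Proof.
move=> I0 leS; have /card_gt0P[i0 _] := I0.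
pose lines x : {set I * {ffun I -> Q}} := [set (i, erase i x) | i : I].
have [|h [h_line h_inj]] := @hall _ _ (i0, [ffun=> o]) lines S.
  move=> T TS; have [->|T0] := eqVneq T set0; first by rewrite cards0.
  have := @loomis_whitney setT T T0; rewrite cardsT.
  under eq_bigl do rewrite inE.
  move=> LW; have {LW} := LW (fun x y _ _ i iT => ltac:(by rewrite inE in iT)) => LW.
  (* Hall's condition: with [d = #|I|], Loomis-Whitney bounds [d^d * #|T|^d] by [#|T|] times the
     [d]-th power of the number of lines, and [#|T| <= d^d]. *)
  apply: (@leq_trans (\sum_i #|erase i @: T|)).
    rewrite -(leq_exp2r _ _ I0) -(@leq_pmul2l #|T|) ?card_gt0 //.
    apply: leq_trans LW; rewrite leq_mul2r; apply/orP; right.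
    exact: leq_trans (subset_leq_card TS) leS.
  rewrite (card_fibers fst); apply: leq_sum => i _.
  rewrite -(card_imset _ (_ : injective (pair i))); last by move=> ? ? [].
  apply/subset_leq_card/subsetP => _ /imsetP[_ /imsetP[x xT ->] ->].
  by rewrite inE eqxx andbT; apply/bigcupP; exists x; rewrite ?imset_f.
(* Player [i] sees the line of direction [i] through [x] and guesses that the colouring is the point
   of [S] to which this line was assigned; on unassigned lines the guess is the default [o]. *)
exists (fun i x => if [pick z in S | h z == (i, erase i x)] is Some z then z i else o).
split=> [i x y /eq_erase -> // | x xS].
have /imsetP[i _ hx] := h_line x xS; exists i.
case: pickP => [z /andP[zS /eqP hz]|/(_ x)]; last by rewrite xS hx eqxx.
by rewrite (h_inj z x) // hz hx.
Qed.

End HatCoordinates.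

(** * Random functions that are onto all large sets *)

Lemma leq_expl (e m n : nat) : m <= n -> m ^ e <= n ^ e.
Proof. by case: e => // e mn; rewrite leq_exp2r. Qed.

Lemma binom_leq_exp (n k : nat) : 'C(n, k) <= n ^ k.
Proof.
apply: (@leq_trans (n ^_ k)); first by rewrite -bin_ffact leq_pmulr ?fact_gt0.
by elim: k => // k IH; rewrite ffactnSr expnSr; apply: leq_mul => //; apply: leq_subr.
Qed.

Lemma card_bigcup_leq (I T : finType) (P : pred I) (F : I -> {set T}) :
  #|\bigcup_(i | P i) F i| <= \sum_(i | P i) #|F i|.
Proof.
apply: (big_ind2 (fun (A : {set T}) m => #|A| <= m)); rewrite ?cards0 //.
by move=> A m B p Am Bp; apply: leq_trans (leq_card_setU _ _) (leq_add Am Bp).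
Qed.

Section OntoFunctions.

Variables (X Q : finType).

Definition onto (f : {ffun X -> Q}) (S : {set X}) : bool := [forall a, a \in f @: S].

(** Union over the missed value [a], which leaves [#|Q| - 1] choices at each point of [S]. *)
Lemma card_not_onto (S : {set X}) :
  #|[set f | ~~ onto f S]| <= #|Q| * (#|Q|.-1 ^ #|S| * #|Q| ^ (#|X| - #|S|)).
Proof.
pose avoid (a : Q) := family (fun x => if x \in S then predC1 a else predT).
apply: (@leq_trans (\sum_(a : Q) #|[set f in avoid a]|)).
  apply: leq_trans (card_bigcup_leq _ _); apply/subset_leq_card/subsetP => f.
  rewrite inE negb_forall => /existsP[a aS]; apply/bigcupP; exists a => //.
  rewrite inE; apply/familyP => x; case: ifP => // xS; rewrite inE.
  by apply: contra aS => /eqP <-; apply: imset_f.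
rewrite -[X in _ <= X]sum_nat_const; apply: leq_sum => a _.
rewrite cardsE card_family foldrE big_map big_enum /= (bigID (mem S)) /=.
rewrite (eq_bigr (fun=> #|Q|.-1)); last first.
  by move=> x ->; rewrite cardC1.
rewrite [X in _ * X](eq_bigr (fun=> #|Q|)); last by move=> x /negPf ->.
rewrite !prod_nat_const leq_mul // leq_eqVlt; apply/orP; left; apply/eqP; congr (_ ^ _).
by rewrite -(cardC S) addKn; apply: eq_card => x; rewrite !inE.
Qed.

(** With [q = #|Q|], the failure probability is at most
    [q * (1 - 1/q)^(2kq) <= q * 4^(-k) <= 1/q]. *)
Lemma card_not_onto_small (k : nat) (S : {set X}) :
  0 < #|Q| <= 2 ^ k -> #|S| = #|Q| * (2 * k) ->
  #|[set f | ~~ onto f S]| * #|Q| <= #|Q| ^ #|X|.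
Proof.
move=> /andP[q0 qk] Sk.
apply: (@leq_trans ((#|Q| * (#|Q|.-1 ^ #|S| * #|Q| ^ (#|X| - #|S|))) * #|Q|)).
  by rewrite leq_mul ?card_not_onto.
rewrite mulnAC mulnA -[in leqRHS](subnKC (max_card (mem S))) expnD leq_mul //.
apply: (@leq_trans (2 ^ (2 * k) * #|Q|.-1 ^ #|S|)).
  by rewrite leq_mul // mul2n -addnn expnD leq_mul.
by rewrite Sk !(expnM _ #|Q|) -expnMn; apply/leq_expl/double_pred_pow.
Qed.

(* Union bound over the sets [S] for a uniformly random family [F]. *)
Lemma exists_onto_family (N k : nat) :
  1 < #|Q| <= 2 ^ k -> #|X| ^ (#|Q| * (2 * k)) < #|Q| ^ N ->
  exists F : {ffun 'I_N -> {ffun X -> Q}}, forall S : {set X},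
    #|S| = #|Q| * (2 * k) -> exists j, onto (F j) S.
Proof.
set s := #|Q| * (2 * k) => /andP[q1 qk] ltXN; have q0 := ltnW q1.
pose good (F : {ffun 'I_N -> {ffun X -> Q}}) :=
  [forall S : {set X}, (#|S| == s) ==> [exists j, onto (F j) S]].
have [/existsP[F /forallP H]|/existsPn H] := boolP [exists F, good F].
  by exists F => S /eqP sS; have := H S; rewrite sS => /existsP.
pose bad (S : {set X}) := [set F : {ffun 'I_N -> {ffun X -> Q}} in ffun_on [set f | ~~ onto f S]].
have : #|[set: {ffun 'I_N -> {ffun X -> Q}}]| <= \sum_(S : {set X} | #|S| == s) #|bad S|.
  apply: leq_trans (card_bigcup_leq _ _); apply/subset_leq_card/subsetP => F _.
  have := H F; rewrite negb_forall => /existsP[S].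
  rewrite negb_imply => /andP[sS /existsPn nF]; apply/bigcupP; exists S => //.
  by rewrite inE; apply/ffun_onP => j; rewrite inE.
rewrite cardsT !card_ffun card_ord -(@leq_pmul2r (#|Q| ^ N)) ?expn_gt0 ?q0 //.
rewrite big_distrl /= => le; move: ltXN; rewrite ltnNge => /negP[].
(* There are at most [#|X|^s] sets [S], and on each all [N] functions fail with probability at most
   [#|Q|^(-N)]. *)
suff : (#|Q| ^ #|X|) ^ N * #|Q| ^ N <= #|X| ^ s * (#|Q| ^ #|X|) ^ N.
  by rewrite mulnC leq_pmul2r // !expn_gt0 q0.
apply: leq_trans le _; apply: leq_trans (leq_mul (binom_leq_exp _ _) (leqnn _)).
rewrite -(card_draws X s) -sum_nat_const.
rewrite [in leqRHS](eq_bigl (fun S : {set X} => #|S| == s)); last by move=> S; rewrite inE.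
apply: leq_sum => S /eqP sS.
by rewrite cardsE card_ffun_on card_ord -expnMn; apply/leq_expl/(@card_not_onto_small k); rewrite ?q0.
Qed.

End OntoFunctions.

(** * The winning strategy on a clique with pages *)

Lemma subset_of_card (T : finType) (A : {set T}) (s : nat) :
  s <= #|A| -> exists2 S : {set T}, S \subset A & #|S| = s.
Proof.
rewrite -bin_gt0 -cards_draws => /card_gt0P[S]; rewrite inE => /andP[SA /eqP sS].
by exists S.
Qed.

Lemma adj_sym (n : nat) (E : {set {set 'I_n}}) (u v : 'I_n) : adj E u v = adj E v u.
Proof. by rewrite /adj eq_sym setUC. Qed.

Lemma adj_neq (n : nat) (E : {set {set 'I_n}}) (u v : 'I_n) : adj E u v -> u != v.
Proof. by case/andP. Qed.

(* Whatever the colours of the pages [p j], fewer than [q * (2 * k)] colourings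
   of the clique make all pages guess wrong, and the clique players, who see all
   the pages, cover these. *)
Lemma book_winning (n q d k N : nat) (E : {set {set 'I_n}})
    (c : 'I_d -> 'I_n) (p : 'I_N -> 'I_n) :
  injective c -> injective p ->
  (forall i j, i != j -> adj E (c i) (c j)) -> (forall i j, adj E (c i) (p j)) ->
  0 < d -> 1 < q <= 2 ^ k -> q * (2 * k) <= d ^ d -> d * (q * (2 * k)) < N ->
  winning q E.
Proof.
move=> c_inj p_inj cc cp d0 /andP[q1 qk] sd dN.
pose X := {ffun 'I_d -> 'I_q}; pose o : 'I_q := Ordinal (ltnW q1).
have [F onF] : exists F : {ffun 'I_N -> {ffun X -> 'I_q}}, forall S : {set X},
    #|S| = q * (2 * k) -> exists j, onto (F j) S.
  have := @exists_onto_family X 'I_q N k; rewrite !card_ffun !card_ord; apply.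
    by rewrite q1.
  by rewrite -expnM ltn_exp2l.
pose restr (col : {ffun 'I_n -> 'I_q}) : X := [ffun i => col (c i)].
(* The clique colourings that make every page guess wrong; they depend only on the colours of the
   pages. *)
pose surv (col : {ffun 'I_n -> 'I_q}) := [set x : X | [forall j, F j x != col (p j)]].
have surv_small col : #|surv col| <= d ^ d.
  (* A larger set of survivors would contain an [S] that some [F j] maps onto all colours, and page
     [j] would guess right at a point of [S]. *)
  apply: leq_trans sd; rewrite leqNgt; apply/negP => /ltnW /subset_of_card[S Ssurv /onF[j]].
  move=> /forallP /(_ (col (p j))) /imsetP[x /(subsetP Ssurv)].
  by rewrite inE => /forallP /(_ j) /eqP H ?; case: H.
have /choice[G GP] : forall S : {set X}, exists g : 'I_d -> X -> 'I_q, #|S| <= d ^ d ->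
    (forall i (x y : X), (forall j, j != i -> x j = y j) -> g i x = g i y) /\
    {in S, forall x : X, exists i, g i x = x i}.
  move=> S; have [leS|_] := leqP #|S| (d ^ d); last by exists (fun _ _ => o).
  by have [||g ?] := @clique_wins_on_small_set 'I_d 'I_q o S; rewrite ?card_ord //; exists g.
(* Clique vertices play the strategy for the current survivors, pages play [F], all other vertices
   guess [o]. Adjacency keeps pages out of the clique, so the order of the tests is harmless. *)
exists (fun v col => if [pick i | c i == v] is Some i then G (surv col) i (restr col)
  else if [pick j | p j == v] is Some j then F j (restr col) else o); split.
  move=> v col col' eqc; case: pickP => [i /eqP cv|_].
    have -> : surv col = surv col'.
      apply/setP => x; rewrite !inE; apply: eq_forallb => j.
      by rewrite eqc // -cv.
    have [+ _] := GP _ (surv_small col'); apply=> j ji.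
    by rewrite !ffunE eqc // -cv cc // eq_sym.
  case: pickP => // j /eqP pv; congr (F j _); apply/ffunP => i.
  by rewrite !ffunE eqc // -pv adj_sym.
move=> col; have [surv_col|] := boolP (restr col \in surv col).
  have [_ /(_ _ surv_col) [i Gi]] := GP _ (surv_small col); exists (c i).
  case: pickP => [i' /eqP /c_inj ->|/(_ i)]; last by rewrite eqxx.
  by rewrite Gi ffunE.
rewrite inE negb_forall => /existsP[j]; rewrite negbK => /eqP Fj; exists (p j).
case: pickP => [i /eqP cpi|_]; first by have := adj_neq (cp i j); rewrite cpi eqxx.
by case: pickP => [j' /eqP /p_inj ->|/(_ j)]; last by rewrite eqxx.
Qed.

(** * Counting graphs without a common neighbour *)

(** For a uniform subset [E] of [P] and disjoint [F u], the events [F u \subset E] are independent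
    of probability [2^(-d)]. The bound is [(1 - 2^(-d))^(size s)] with denominators cleared. *)
Lemma card_avoid (T V : finType) (P : {set T}) (F : V -> {set T}) (d : nat) (s : seq V) :
  uniq s -> {in s, forall u, F u \subset P} -> {in s, forall u, #|F u| = d} ->
  {in s &, forall u v, u != v -> [disjoint F u & F v]} ->
  #|[set E in powerset P | all (fun u => ~~ (F u \subset E)) s]| * 2 ^ (d * size s)
    <= 2 ^ #|P| * (2 ^ d).-1 ^ size s.
Proof.
elim: s => [|u s IH] /=.
  move=> _ _ _ _; rewrite muln0 !muln1 -card_powerset; apply/subset_leq_card/subsetP => E.
  by rewrite inE => /andP[].
move=> /andP[us s_uniq] FP Fd Fdis.
have sub v : v \in s -> v \in u :: s by rewrite inE orbC => ->.
have {}IH := IH s_uniq (fun v vs => FP v (sub v vs)) (fun v vs => Fd v (sub v vs))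
  (fun v w vs ws => Fdis v w (sub v vs) (sub w ws)).
set A := [set E in powerset P | all _ s] in IH.
have u_us : u \in u :: s by rewrite inE eqxx.
set A' := [set E in powerset P | _ && _].
pose A'' := [set E in A | F u \subset E].
have cA : #|A| = #|A'| + #|A''|.
  rewrite (card_fibers (fun E : {set T} => F u \subset E) A) big_bool [RHS]addnC; congr (_ + _).
    by apply: eq_card => E; rewrite !inE; case: (F u \subset E); rewrite ?(andbT, andbF).
  by apply: eq_card => E; rewrite !inE; case: (F u \subset E); rewrite ?(andbT, andbF).
have leA : #|A| <= #|A''| * 2 ^ d.
  rewrite -(Fd u u_us) -card_powerset -cardsX.
  (* At least a fraction [2^(-d)] of [A] contains [F u]: adding [F u] to [E] keeps it in [A] by
     disjointness, and [E] is recovered from the union and its trace on [F u]. *)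
  pose f (E : {set T}) := (E :|: F u, E :&: F u).
  rewrite -(card_in_imset (f := f) (D := mem A)); last first.
    move=> E1 E2 _ _ [e1 e2]; apply/setP => x; move/setP/(_ x): e1; move/setP/(_ x): e2.
    by rewrite !inE; case: (x \in F u); rewrite ?andbT ?orbF.
  apply/subset_leq_card/subsetP => _ /imsetP[E EA ->].
  move: EA; rewrite !inE subsetUr subsetIr !andbT => /andP[EP /allP Es].
  rewrite subUset EP FP //=; apply/allP => v vs; apply: contra (Es v vs) => Fv.
  have dis : [disjoint F v & F u].
    by apply: Fdis (sub v vs) u_us _; apply: contraNneq us => <-.
  apply/subsetP => x xv; have := subsetP Fv x xv; rewrite inE.
  by rewrite (disjointFr dis xv) orbF.
rewrite mulnS expnD mulnA expnS [leqRHS]mulnCA.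
apply: leq_trans (leq_mul (leqnn _) IH); rewrite mulnA leq_mul2r; apply/orP; right.
have : 0 < 2 ^ d by rewrite expn_gt0.
by case: (2 ^ d) leA => // e; rewrite cA /=; nia.
Qed.

Definition pairs (n : nat) : {set {set 'I_n}} := [set e : {set 'I_n} | #|e| == 2].

Lemma graphsE (n : nat) : graphs n = powerset (pairs n).
Proof.
apply/setP => E; rewrite !inE; apply/forall_inP/subsetP => H e /H //; by rewrite inE.
Qed.

(** For [u] outside [K], being a common neighbour of [K] becomes the containment
    [star K u \subset E], as [card_avoid] requires. *)
Definition star (n : nat) (K : {set 'I_n}) (u : 'I_n) : {set {set 'I_n}} :=
  [set [set u; x] | x in K].

Lemma star_subset (n : nat) (E : {set {set 'I_n}}) (K : {set 'I_n}) (u : 'I_n) :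
  u \notin K -> star K u \subset E -> [forall x in K, adj E x u].
Proof.
move=> uK KE; apply/forall_inP => x xK; rewrite adj_sym /adj.
by apply/andP; split; [apply: contraNneq uK => -> | apply/(subsetP KE)/imset_f].
Qed.

Lemma card_star (n : nat) (K : {set 'I_n}) (u : 'I_n) : u \notin K -> #|star K u| = #|K|.
Proof.
move=> uK; apply: card_in_imset => x y xK yK /setP /(_ x).
rewrite !inE eqxx orbT => /esym /orP[/eqP xu|/eqP //].
by move: uK; rewrite -xu xK.
Qed.

Lemma disjoint_star (n : nat) (K : {set 'I_n}) (u v : 'I_n) :
  u \notin K -> v \notin K -> u != v -> [disjoint star K u & star K v].
Proof.
move=> uK vK uv; rewrite disjoint_subset; apply/subsetP => _ /imsetP[x xK ->].
rewrite inE; apply/negP => /imsetP[y yK /setP /(_ u)].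
rewrite !inE eqxx (negPf uv) /= => /esym /eqP uy.
by move: uK; rewrite uy yK.
Qed.

Lemma star_pairs (n : nat) (K : {set 'I_n}) (u : 'I_n) : u \notin K -> star K u \subset pairs n.
Proof.
move=> uK; apply/subsetP => _ /imsetP[x xK ->]; rewrite inE cards2.
by have -> : u != x by apply: contraNneq uK => ->.
Qed.

(** At least [r] vertices of [B] lie outside [K], and their stars to [K] are disjoint sets of [#|K|]
    pairs. *)
Lemma card_no_common_neighbour (n r : nat) (K B : {set 'I_n}) :
  r + #|K| <= #|B| ->
  #|[set E in graphs n | ~~ [exists v in B, [forall x in K, adj E x v]]]| * 2 ^ (#|K| * r)
    <= #|graphs n| * (2 ^ #|K|).-1 ^ r.
Proof.
move=> rB; have : r <= #|B :\: K|.
  by rewrite cardsD; have := subset_leq_card (subsetIr B K); lia.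
case/subset_of_card => R /subsetP RBK Rr.
have notK u : u \in enum R -> u \notin K by rewrite mem_enum => /RBK; rewrite inE => /andP[].
have := @card_avoid _ _ (pairs n) (star K) #|K| (enum R) (enum_uniq _).
rewrite -cardE Rr graphsE card_powerset => H; apply: leq_trans (H _ _ _).
- rewrite leq_mul2r; apply/orP; right; apply/subset_leq_card/subsetP => E.
  rewrite 2!inE => /andP[EP noc]; rewrite !inE EP; apply/allP => u uR.
  apply: contra noc => uE; apply/exists_inP; exists u; last exact: star_subset (notK u uR) uE.
  by move: uR; rewrite mem_enum => /RBK; rewrite inE => /andP[].
- by move=> u /notK /star_pairs.
- by move=> u /notK /card_star.
- by move=> u v /notK uK /notK vK; apply: disjoint_star.
Qed.

(** * Blocks and the extension property *)

(** Blocks with different [j] are disjoint, so pages taken from different blocks are distinct. *)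
Definition block (n m j : nat) : {set 'I_n} := [set v : 'I_n | v %/ m == j].

Lemma card_block (n m N j : nat) : N * m <= n -> j < N -> m <= #|block n m j|.
Proof.
move=> Nmn jN; have lt (i : 'I_m) : j * m + i < n.
  by apply: leq_trans Nmn; apply: leq_trans (leq_mul jN (leqnn m)); rewrite mulSn addnC ltn_add2r.
rewrite -[leqLHS]card_ord -(card_imset _ (_ : injective (fun i => Ordinal (lt i)))); last first.
  by move=> i i' [] /addnI /val_inj.
apply/subset_leq_card/subsetP => _ /imsetP[i _ ->]; rewrite inE /=.
have m0 : 0 < m by case: (m) i => [[]|].
by rewrite divnMDl // divn_small // addn0.
Qed.

Definition extendable (n d m N : nat) (E : {set {set 'I_n}}) : bool :=
  [forall K : {set 'I_n}, (#|K| == d) ==>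
    [forall j : 'I_N, [exists v in block n m j, [forall x in K, adj E x v]]]].

(** Union bound over at most [n^d] sets [K] and over [N] blocks. The width [r + d] leaves [r]
    vertices of each block outside [K]. *)
Lemma card_not_extendable (n d r N : nat) :
  N * (r + d) <= n ->
  #|[set E in graphs n | ~~ extendable d (r + d) N E]| * 2 ^ (d * r)
    <= n ^ d * (N * (#|graphs n| * (2 ^ d).-1 ^ r)).
Proof.
move=> Nn.
pose bad (K : {set 'I_n}) (j : 'I_N) :=
  [set E in graphs n | ~~ [exists v in block n (r + d) j, [forall x in K, adj E x v]]].
apply: (@leq_trans ((\sum_(K : {set 'I_n} | #|K| == d) \sum_j #|bad K j|) * 2 ^ (d * r))).
  rewrite leq_mul2r; apply/orP; right.
  apply: (@leq_trans (\sum_(K : {set 'I_n} | #|K| == d) #|\bigcup_j bad K j|)); last first.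
    by apply: leq_sum => K _; apply: card_bigcup_leq.
  apply: leq_trans (card_bigcup_leq _ _); apply/subset_leq_card/subsetP => E.
  rewrite inE negb_forall => /andP[EG /existsP[K]]; rewrite negb_imply => /andP[Kd].
  rewrite negb_forall => /existsP[j Ej]; apply/bigcupP; exists K => //.
  by apply/bigcupP; exists j; rewrite // inE EG.
rewrite big_distrl /=; apply: leq_trans (leq_mul (binom_leq_exp n d) (leqnn _)).
have <- : #|[set K : {set 'I_n} | #|K| == d]| = 'C(n, d) by rewrite card_draws card_ord.
rewrite -sum_nat_const [leqRHS](eq_bigl (fun K : {set 'I_n} => #|K| == d)); last by move=> K; rewrite inE.
apply: leq_sum => K /eqP Kd; rewrite big_distrl -[in leqRHS](card_ord N) -sum_nat_const /=.
apply: leq_sum => j _.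
have := @card_no_common_neighbour n r K (block n (r + d) j); rewrite Kd; apply.
exact: card_block Nn _.
Qed.

(** A clique with [l < d] vertices is padded to [d] vertices; a common neighbour of the padded set
    is a new vertex that enlarges the clique. *)
Lemma extendable_clique (n d m N : nat) (E : {set {set 'I_n}}) :
  extendable d m N E -> 0 < N -> d <= n ->
  exists2 K : {set 'I_n}, #|K| = d & {in K &, forall x y, x != y -> adj E x y}.
Proof.
move=> ext N0 dn.
suff H l : l <= d -> exists2 K : {set 'I_n}, #|K| = l & {in K &, forall x y, x != y -> adj E x y}.
  exact: H.
elim: l => [_|l IH ld]; first by exists set0; rewrite ?cards0 // => x y; rewrite inE.
have [K Kl Kc] := IH (ltnW ld).
have [|R RK Rd] := @subset_of_card _ (~: K) (d - l).
  by rewrite -(leq_add2l #|K|) cardsC card_ord Kl subnKC // ltnW.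
have KRd : #|K :|: R| == d.
  have := RK; rewrite -disjoints_subset disjoint_sym => /disjoint_setI0 dis.
  by rewrite cardsU dis cards0 subn0 Rd Kl subnKC // ltnW.
move/forallP/(_ (K :|: R)): ext; rewrite KRd => /forallP /(_ (Ordinal N0)).
move=> /exists_inP[v _ /forall_inP vKR].
have vK x : x \in K -> adj E x v by move=> xK; apply: vKR; rewrite inE xK.
exists (v |: K); first by rewrite cardsU1 Kl; case: (boolP (v \in K)) => [/vK /adj_neq|]; rewrite ?eqxx.
move=> x y; rewrite !inE => /predU1P[->|xK] /predU1P[->|yK]; rewrite ?eqxx //.
- by rewrite adj_sym => _; apply: vK.
- by move=> _; apply: vK.
- exact: Kc.
Qed.

(** Page [j] is a common neighbour of the clique in block [j]. *)
Lemma extendable_winning (n q d k m N : nat) (E : {set {set 'I_n}}) :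
  extendable d m N E -> 0 < d <= n -> 1 < q <= 2 ^ k -> q * (2 * k) <= d ^ d ->
  d * (q * (2 * k)) < N -> winning q E.
Proof.
move=> ext /andP[d0 dn] qk sd dN.
have [K Kd Kc] := extendable_clique ext (leq_ltn_trans (leq0n _) dN) dn.
pose c (i : 'I_d) := enum_val (cast_ord (esym Kd) i).
have c_inj : injective c by move=> i j /enum_val_inj /cast_ord_inj.
have cK i : c i \in K by apply: enum_valP.
have /choice[p pP] : forall j : 'I_N, exists v : 'I_n,
    v %/ m = j /\ forall i, adj E (c i) v.
  move=> j; move/forallP/(_ K): ext; rewrite Kd eqxx => /forallP /(_ j).
  move=> /exists_inP[v + /forall_inP vK]; rewrite inE => /eqP vj; exists v.
  by split=> // i; apply: vK.
apply: (@book_winning n q d k N E c p) => //.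
- by move=> j j' e; apply: val_inj; rewrite /= -(pP j).1 e (pP j').1.
- by move=> i j ij; apply: Kc => //; rewrite (inj_eq c_inj).
- by move=> i j; apply: (pP j).2.
Qed.

(** * Choice of parameters *)

(** Lets [2^(2^d)] beat the union bound: [n < (8 (d + 1))^(d + 1)] gives
    [n^(d + 1) <= 2^((d + 3) (d + 1)^2)], and a factor [2^d] remains. *)
Lemma cubic_leq_exp2 (d : nat) : 12 <= d -> (d + 3) * d.+1 ^ 2 + d <= 2 ^ d.
Proof.
elim: d => // d IH; rewrite leq_eqVlt => /predU1P[<- //|]; rewrite ltnS => d12.
rewrite [in leqRHS]expnS; apply: leq_trans (leq_mul (leqnn 2) (IH d12)).
by rewrite -(subnKC d12) !expnS !expn0 !muln1; set e := d - 12; nia.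
Qed.

Lemma card_not_winning (n d : nat) :
  12 <= d -> (8 * d) ^ d <= n < (8 * d.+1) ^ d.+1 ->
  #|[set E in graphs n | ~~ `[< winning (d ^ (d - 3)) E >]]| * d <= #|graphs n|.
Proof.
(* With [q = d^(d - 3)] and [k = d^2], [d * (q * (2 * k)) = 2 d^d < N]. With [r = 4^d], a given set
   has no common neighbour in a given block with probability at most [(1 - 2^(-d))^r <= 2^(-2^d)],
   and the [N] blocks fit since [3 (4^d + d) <= 8^d]. *)
move=> d12 /andP[n_ge n_lt]; set N := 3 * d ^ d; set r := 2 ^ d * 2 ^ d.
have d0 : 0 < d by apply: leq_trans d12.
have d2d : d <= 2 ^ d by apply/ltnW/ltn_expl.
have d6 : 6 <= 2 ^ d by apply: leq_trans d2d; apply: leq_trans d12.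
have Nn : N * (r + d) <= n.
  apply: leq_trans n_ge; rewrite expnMn mulnC mulnA leq_mul2r; apply/orP; right.
  rewrite (_ : 8 = 2 * 2 * 2) // !expnMn /r; nia.
have dn : d <= n by apply: leq_trans Nn; rewrite /N /r; nia.
have Ndn : N <= n by apply: leq_trans Nn; rewrite leq_pmulr // addn_gt0 d0 orbT.
have dE : d ^ d = d ^ (d - 3) * (d * d * d).
  have := expnD d (d - 3) 3; rewrite subnK ?(leq_trans _ d12) // => ->.
  by congr (_ * _); rewrite !expnS expn0 muln1 mulnA.
have q_gt1 : 1 < d ^ (d - 3).
  apply: (@leq_trans (d ^ 1)); first by rewrite expn1 (leq_trans _ d12).
  by rewrite leq_pexp2l // subn_gt0 (leq_trans _ d12).
pose bad := [set E in graphs n | ~~ extendable d (r + d) N E].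
apply: (@leq_trans (#|bad| * 2 ^ d)).
  apply: leq_mul => //; apply/subset_leq_card/subsetP => E.
  rewrite !inE => /andP[-> /=]; apply: contra => ext; apply/asboolP.
  apply: (@extendable_winning n _ d (d * d) _ _ E ext); rewrite ?d0 ?q_gt1 //=.
  - rewrite expnM; apply: leq_trans (leq_expl d d2d); rewrite leq_pexp2l //; lia.
  - rewrite dE leq_mul2l; apply/orP; right; nia.
  - rewrite /N dE; set q := d ^ _ in q_gt1 *; nia.
have := card_not_extendable Nn; rewrite -/bad => H.
(* The number [N] of blocks is absorbed into one more factor [n]. *)
have H1 : #|bad| * 2 ^ 2 ^ d <= n ^ d.+1 * #|graphs n|.
  have r0 : 0 < 2 ^ (d * r) by rewrite expn_gt0.
  rewrite -(leq_pmul2r r0) mulnAC; apply: leq_trans (leq_mul H (leqnn _)) _.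
  have H2 : (2 ^ d).-1 ^ r * 2 ^ 2 ^ d <= 2 ^ (d * r).
    rewrite mulnC [2 ^ (d * r)]expnM /r !(expnM _ (2 ^ d)) -expnMn.
    by apply/leq_expl/double_pred_pow; rewrite expn_gt0.
  have -> : n ^ d * (N * (#|graphs n| * (2 ^ d).-1 ^ r)) * 2 ^ 2 ^ d
     = n ^ d * N * #|graphs n| * ((2 ^ d).-1 ^ r * 2 ^ 2 ^ d) by rewrite !mulnA.
  by rewrite expnSr; do 3 apply: leq_mul => //.
have e : n ^ d.+1 <= 2 ^ ((d + 3) * d.+1 ^ 2).
  have -> : 2 ^ ((d + 3) * d.+1 ^ 2) = ((2 ^ (d + 3)) ^ d.+1) ^ d.+1.
    by rewrite -!expnM.
  apply/leq_expl/(leq_trans (ltnW n_lt))/leq_expl.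
  by rewrite expnD mulnC; apply: leq_mul => //; apply: ltn_expl.
have c0 : 0 < 2 ^ ((d + 3) * d.+1 ^ 2) by rewrite expn_gt0.
rewrite -(leq_pmul2l c0) mulnCA -expnD.
apply: leq_trans (leq_trans H1 _); last by rewrite leq_mul2r e orbT.
by rewrite leq_mul2l leq_pexp2l ?cubic_leq_exp2 ?orbT.
Qed.

(** * Asymptotics *)

(** The largest [d] with [(8 * d)^d <= n], of order [log n / log log n]; [d = 0] qualifies because
    [0^0 = 1]. *)
Lemma self_power_bracket (n : nat) :
  0 < n -> exists d, (8 * d) ^ d <= n < (8 * d.+1) ^ d.+1.
Proof.
move=> n0; have ex : exists d, (8 * d) ^ d <= n by exists 0.
have bound d : (8 * d) ^ d <= n -> d <= n.
  case: d => // d; apply: leq_trans; apply: leq_trans (_ : (8 * d.+1) ^ 1 <= _).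
    by rewrite expn1 leq_pmull.
  by rewrite leq_pexp2l.
case: (ex_maxnP ex bound) => d le max; exists d; rewrite le ltnNge.
by apply/negP => /max; rewrite ltnn.
Qed.

Lemma self_power_leq (d e : nat) : 0 < d <= e -> (8 * d) ^ d <= (8 * e) ^ e.
Proof.
move=> /andP[d0 de]; apply: leq_trans (_ : (8 * d) ^ e <= _).
  by rewrite leq_pexp2l // muln_gt0.
by apply: leq_expl; rewrite leq_mul2l.
Qed.

Lemma INR_expn (m k : nat) : INR (m ^ k) = (INR m ^ k)%R.
Proof. by elim: k => [|k IH]; rewrite ?expnS -?multE ?mult_INR ?IH. Qed.

Lemma ln_INR_expn (m k : nat) : 0 < m -> ln (INR (m ^ k)) = (INR k * ln (INR m))%R.
Proof. by move=> m0; rewrite INR_expn ln_pow //; apply/lt_0_INR/ltP. Qed.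

Lemma prob_Gn_ge (n d : nat) (P : {set {set 'I_n}} -> Prop) :
  0 < d -> #|[set E in graphs n | ~~ `[< P E >]]| * d <= #|graphs n| ->
  (Rabs (prob_Gn P - 1) <= / INR d)%R.
Proof.
move=> d0; set b := #|[set E in _ | _]|; set a := #|[set E in graphs n | `[< P E >]]| => bd.
have ab : #|graphs n| = a + b.
  rewrite (card_fibers (fun E => `[< P E >]) (graphs n)) big_bool /=; congr (_ + _).
    by apply: eq_card => E; rewrite !inE; case: `[< P E >].
  by apply: eq_card => E; rewrite !inE; case: `[< P E >].
have G0 : (0 < INR #|graphs n|)%R.
  apply/lt_0_INR/ltP; rewrite graphsE card_powerset; exact: expn_gt0.
have dR : (0 < INR d)%R by apply/lt_0_INR/ltP.
have bdR : (INR b * INR d <= INR #|graphs n|)%R by rewrite -mult_INR; apply/le_INR/leP.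
rewrite /prob_Gn -/a.
set G := INR #|graphs n| in G0 bdR *; have aE : INR a = (G - INR b)%R.
  by rewrite /G ab plus_INR; lra.
have b0 := pos_INR b.
have -> : (INR a / G - 1 = - (INR b / G))%R by rewrite aE; field; lra.
rewrite Rabs_Ropp Rabs_pos_eq; last by apply: Rle_mult_inv_pos.
apply: (Rmult_le_reg_r (G * INR d)%R); first by apply: Rmult_lt_0_compat.
have -> : (INR b / G * (G * INR d) = INR b * INR d)%R by field; lra.
by have -> : (/ INR d * (G * INR d) = G)%R by field; lra.
Qed.

(* [12] comes from [(d + 1) ln (8 (d + 1)) - (d - 3) ln d <= 12 d]. *)
Lemma exponent_bound (n d : nat) :
  12 <= d -> (8 * d) ^ d <= n < (8 * d.+1) ^ d.+1 ->
  (0 <= 1 - ln (INR (d ^ (d - 3))) / ln (INR n) <= 12 / ln (INR d))%R.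
Proof.
move=> d12 /andP[n_ge n_lt]; have d0 : 0 < d by apply: leq_trans d12.
have DR : (12 <= INR d)%R.
  have := le_INR 12 d (elimT leP d12); rewrite !S_INR /=; lra.
have n0 : 0 < n by apply: leq_trans n_ge; rewrite expn_gt0 muln_gt0 d0.
have nR : (0 < INR n)%R by apply/lt_0_INR/ltP.
rewrite ln_INR_expn // minus_INR; last by apply/leP; apply: leq_trans d12.
have ln_le x y : (0 < x -> x <= y -> ln x <= ln y)%R.
  by move=> x0 [/(ln_increasing _ _ x0)|->]; lra.
have ln2 : (0 < ln 2 < 1)%R.
  split; first by have := ln_lt_2; lra.
  rewrite -[X in (_ < X)%R]ln_exp; apply: ln_increasing; first lra.
  by have := exp_ineq1 1; lra.
have l_gt0 : (0 < ln (INR d))%R by rewrite -ln_1; apply: ln_increasing; lra.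
have l_le : (ln (INR d) <= INR d)%R.
  rewrite -[X in (_ <= X)%R]ln_exp; apply: ln_le; first lra.
  by have := exp_ineq1_le (INR d); lra.
have lo : (INR d * ln (INR d) <= ln (INR n))%R.
  rewrite -ln_INR_expn //; apply: ln_le; first by apply/lt_0_INR/ltP; rewrite expn_gt0 d0.
  by apply/le_INR/leP; apply: leq_trans n_ge; apply: leq_expl; rewrite leq_pmull.
(* The [4] comes from [8 (d + 1) <= 2^4 d] and [ln 2 < 1]. *)
have hi : (ln (INR n) <= (INR d + 1) * (4 + ln (INR d)))%R.
  apply: (@Rle_trans _ (ln (INR ((8 * d.+1) ^ d.+1)))).
    by apply: ln_le => //; apply/le_INR/leP/ltnW.
  rewrite ln_INR_expn // S_INR; apply: Rmult_le_compat_l; first lra.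
  apply: (@Rle_trans _ (ln (2 ^ 4 * INR d))); last first.
    rewrite ln_mult; [|lra|lra]; rewrite ln_pow; last lra.
    by rewrite /=; lra.
  have -> : INR (8 * d.+1) = (8 * (INR d + 1))%R.
    by rewrite -multE mult_INR (S_INR d); congr Rmult; rewrite /=; lra.
  by apply: ln_le; lra.
set l := ln (INR d) in l_gt0 l_le lo hi *; set D := INR d in DR l_le lo hi *.
set L := ln (INR n) in lo hi *.
have L0 : (0 < L)%R by nra.
have -> : INR 3 = 3%R by rewrite /=; lra.
split.
  suff : ((D - 3) * l / L <= 1)%R by lra.
  apply: (Rmult_le_reg_r L) => //; rewrite /Rdiv Rmult_assoc Rinv_l; nra.
apply: (Rmult_le_reg_r L) => //.
have -> : ((1 - (D - 3) * l / L) * L = L - (D - 3) * l)%R by field; lra.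
(* [(D + 1) (4 + l) - (D - 3) l = 4 D + 4 + 4 l <= 12 D], as [l <= D]. *)
apply: (@Rle_trans _ (12 * D)%R); first nra.
have -> : (12 * D = 12 / l * (D * l))%R by field; lra.
by apply: Rmult_le_compat_l => //; apply: Rlt_le; apply: Rdiv_lt_0_compat; lra.
Qed.

Theorem theorem2 :
  exists eps : nat -> R,
    Un_cv eps 0%R /\
    Un_cv (fun n : nat =>
             prob_Gn (fun E : {set {set 'I_n}} =>
                        HG_ge E (Rpower (INR n) (1 - eps n)))) 1%R.
Proof.
have /choice[d dP] : forall n, exists d, 0 < n -> (8 * d) ^ d <= n < (8 * d.+1) ^ d.+1.
  by case=> [|n]; [exists 0 | have [d dn] := self_power_bracket (ltn0Sn n); exists d].
(* [d n] tends to infinity: if [d n < D], then [n < (8 * D)^D] by monotonicity. *)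
have d_large D n : 0 < D -> (8 * D) ^ D <= n -> D <= d n.
  move=> D0 Dn; have n0 : 0 < n by apply: leq_trans Dn; rewrite expn_gt0 muln_gt0 D0.
  have /andP[_ lt] := dP n n0; rewrite leqNgt; apply/negP => dD.
  by move: (leq_trans lt (leq_trans (self_power_leq (d := (d n).+1) dD) Dn)); rewrite ltnn.
have large (x : R) : exists n0, forall n, n0 <= n -> [/\ 12 <= d n, 0 < n & (x < INR (d n))%R].
  have [m mx] := INR_unbounded x; exists ((8 * (maxn 12 m)) ^ maxn 12 m) => n n0n.
  have dn : maxn 12 m <= d n by apply: d_large n0n; rewrite leq_max.
  move: dn; rewrite geq_max => /andP[d12 md]; split => //.
    by apply: leq_trans n0n; rewrite expn_gt0 muln_gt0 leq_max.
  by apply: Rlt_le_trans mx _; apply/le_INR/leP.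
pose q n := d n ^ (d n - 3).
(* Chosen so that [n^(1 - eps n)] is exactly [q n]. *)
exists (fun n => 1 - ln (INR (q n)) / ln (INR n))%R; split => e e0.
  (* [eps n <= 12 / ln (d n)], which is below [e] once [d n > exp (12 / e)]. *)
  have [n0 n0P] := large (exp (12 / e)); exists n0 => n /leP /n0P[d12 n_gt0 de].
  have [ge0 le] := exponent_bound d12 (dP n n_gt0).
  rewrite /R_dist Rminus_0_r Rabs_pos_eq //; apply: Rle_lt_trans le _.
  have ld : (12 / e < ln (INR (d n)))%R.
    by rewrite -[X in (X < _)%R]ln_exp; apply: ln_increasing de; apply: exp_pos.
  have l0 : (0 < 12 / e)%R by apply: Rdiv_lt_0_compat; lra.
  apply: (Rmult_lt_reg_r (ln (INR (d n)))); first lra.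
  rewrite /Rdiv Rmult_assoc Rinv_l; last lra.
  have -> : (12 * 1 = e * (12 / e))%R by field; lra.
  by apply: Rmult_lt_compat_l.
(* The probability is within [1 / d n] of [1]. *)
have [n0 n0P] := large (/ e)%R; exists n0 => n /leP /n0P[d12 n_gt0 de].
have d0 : 0 < d n by apply: leq_trans d12.
have ie : (0 < / e)%R by apply: Rinv_0_lt_compat.
apply: (@Rle_lt_trans _ (/ INR (d n))%R); last first.
  by rewrite -(Rinv_inv e); apply: Rinv_lt_contravar => //; nra.
apply: prob_Gn_ge => //.
apply: leq_trans (card_not_winning d12 (dP n n_gt0)); rewrite leq_mul2r; apply/orP; right.
apply/subset_leq_card/subsetP => E; rewrite !inE => /andP[-> /=]; apply: contra => /asboolP winE.
apply/asboolP; exists (q n); split; last exact: winE.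
have q0 : (0 < INR (q n))%R by apply/lt_0_INR/ltP; rewrite expn_gt0 d0.
have [_ n_lt] := andP (dP n n_gt0).
(* Needed for [ln n] to be nonzero when the exponent is simplified. *)
have n1 : (1 < INR n)%R.
  have [n_ge _] := andP (dP n n_gt0).
  apply: (lt_INR 1); apply/ltP; apply: leq_trans n_ge; apply: (@leq_trans ((8 * d n) ^ 1)).
    by rewrite expn1; lia.
  by rewrite leq_pexp2l // muln_gt0.
right; rewrite /Rpower -[RHS]exp_ln //; congr exp; field.
by have := ln_increasing 1 _ Rlt_0_1 n1; rewrite ln_1; lra.
Qed.
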